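(* Let $1\le\alpha<\omega^\omega$ be an ordinal, $k$ a nonnegative integer, and $u$ a congruence class modulo $3$. Then \[\overline{\mathscr{D}^{u+k}}(\omega^k\alpha)=\overline{\mathscr{D}^{u}}(\alpha)+k.\]
   Context: For a natural number $n$, $\|n\|$ denotes its integer complexity (the least number of $1$'s needed to write $n$ using $1$, $+$, $\cdot$ and parentheses), and $\delta(n)=\|n\|-3\log_3 n$ its defect. For a congruence class $u$ modulo $3$, $\mathscr{D}^u=\{\delta(n): n>1,\ \|n\|\equiv u\pmod 3\}$, and $\overline{\mathscr{D}^u}$ denotes its closure in $\mathbb{R}$ (a well-ordered set). Indexing convention: for a well-ordered set $S$ and an ordinal $\beta$, $S[\beta]$ denotes the element of $S$ whose set of predecessors in $S$ has order type $\beta$, and for $\alpha\ge1$, $S(\alpha)$ denotes $S[\beta]$ where $\beta$ is the unique ordinal with $1+\beta=\alpha$. *)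

(* Defs.v *)
From Stdlib Require Import Relation_Operators Wellfounded Wf_nat.
From mathcomp Require Import all_boot all_order all_algebra.
From mathcomp Require Import all_classical all_reals all_analysis.
Set Implicit Arguments.
Unset Strict Implicit.
Unset Printing Implicit Defensive.
Import Order.TTheory GRing.Theory Num.Theory numFieldNormedType.Exports.
Local Open Scope classical_set_scope.
Local Open Scope ring_scope.

Inductive expr : Type :=
| One
| Add of expr & expr
| Mul of expr & expr.

Fixpoint value (e : expr) : nat :=
  match e with
  | One => 1%N
  | Add e1 e2 => (value e1 + value e2)%N
  | Mul e1 e2 => (value e1 * value e2)%N
  end.

Fixpoint num_ones (e : expr) : nat :=
  match e with
  | One => 1%N
  | Add e1 e2 => (num_ones e1 + num_ones e2)%N
  | Mul e1 e2 => (num_ones e1 + num_ones e2)%N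
  end.

Definition least_num_ones (n c : nat) : Prop :=
  (exists e, value e = n /\ num_ones e = c) /\
  (forall e, value e = n -> (c <= num_ones e)%N).

(* No expression has value 0, so [complexity 0] is the default [0]. *)
Definition complexity (n : nat) : nat := xget 0%N (least_num_ones n).

Lemma complexityP n : (0 < n)%N -> least_num_ones n (complexity n).
Proof.
move=> n_gt0.
have ex_c : exists c, `[< exists e, value e = n /\ num_ones e = c >].
  exists n; apply/asboolP; exists (iter n.-1 (Add One) One).
  by case: n n_gt0 => // n _; elim: n => //= n [-> ->].
case: (ex_minnP ex_c) => c /asboolP ce c_min.
apply: (@xgetPex _ 0%N (least_num_ones n)); exists c; split=> // e en.
by apply: c_min; apply/asboolP; exists e.
Qed.

Definition defect (R : realType) (n : nat) : R :=
  (complexity n)%:R - 3 * (ln n%:R / ln 3).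

Definition defects (R : realType) (u : 'Z_3) : set R :=
  [set d | exists n, [/\ (1 < n)%N, (complexity n)%:R = u & d = defect R n]].
Arguments defects : clear implicits.

(* Ordinals are represented by well-ordered types; equality of ordinals is
   order isomorphism, [wo_eq] below. *)
Record wellord : Type := Wellord {
  wo_sort :> Type;
  wo_rel : wo_sort -> wo_sort -> Prop;
  wo_wf : well_founded wo_rel;
  wo_trans : forall x y z, wo_rel x y -> wo_rel y z -> wo_rel x z;
  wo_total : forall x y, [\/ wo_rel x y, x = y | wo_rel y x]
}.

(* [P] has order type [a] under the relation [lt]; since [wo_rel a] is total,
   [f] is injective as soon as [lt] is irreflexive. *)
Definition has_order_type (T : Type) (lt : T -> T -> Prop) (P : set T)
    (a : wellord) : Prop :=
  exists f : a -> T, (forall i j, wo_rel i j <-> lt (f i) (f j)) /\ range f = P.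

Definition wo_eq (a b : wellord) : Prop := has_order_type (@wo_rel b) setT a.

Definition wo_lt (a b : wellord) : Prop :=
  exists j : b, has_order_type (@wo_rel b) [set i | wo_rel i j] a.

Definition wo_le (a b : wellord) : Prop := wo_lt a b \/ wo_eq a b.

Section Arithmetic.
Implicit Types a b : wellord.

Lemma one_wf : well_founded (fun _ _ : unit => False).
Proof. by move=> x; split. Qed.

Lemma one_total (x y : unit) : [\/ False, x = y | False].
Proof. by case: x y => [] []; apply: Or32. Qed.

Definition wo_one : wellord :=
  @Wellord unit (fun _ _ => False) one_wf (fun _ _ _ H _ => H) one_total.

Let ltn_wf : well_founded (fun m n : nat => (m < n)%N).
Proof. by apply: (well_founded_lt_compat _ id) => m n /ssrnat.ltP. Qed.

Let ltn_trans3 (x y z : nat) : (x < y)%N -> (y < z)%N -> (x < z)%N.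
Proof. exact: ltn_trans. Qed.

Let ltn_total3 (x y : nat) : [\/ (x < y)%N, x = y | (y < x)%N].
Proof.
by case: (ltngtP x y) => ?; [apply: Or31 | apply: Or33 | apply: Or32].
Qed.

Definition wo_omega : wellord :=
  @Wellord nat (fun m n => (m < n)%N) ltn_wf ltn_trans3 ltn_total3.

Let add_rel a b := @le_AsB a b (@wo_rel a) (@wo_rel b).

Let add_wf a b : well_founded (@add_rel a b).
Proof. by apply: wf_disjoint_sum; apply: wo_wf. Qed.

Let add_trans a b x y z :
  @add_rel a b x y -> @add_rel a b y z -> @add_rel a b x z.
Proof.
case: x y z => [x|x] [y|y] [z|z] xy yz;
  inversion xy; inversion yz; subst; constructor; exact: (@wo_trans _ _ y).
Qed.

Let add_total a b x y : [\/ @add_rel a b x y, x = y | @add_rel a b y x].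
Proof.
case: x y => [x|x] [y|y].
- case: (wo_total x y) => [?|->|?].
  + by apply: Or31; constructor.
  + exact: Or32.
  + by apply: Or33; constructor.
- by apply: Or31; constructor.
- by apply: Or33; constructor.
- case: (wo_total x y) => [?|->|?].
  + by apply: Or31; constructor.
  + exact: Or32.
  + by apply: Or33; constructor.
Qed.

Definition wo_add a b : wellord :=
  Wellord (@add_wf a b) (@add_trans a b) (@add_total a b).

(* The ordinal product a * b is b copies of a, so the coordinate in b is the
   most significant one. *)
Let mul_rel a b := @slexprod b a (@wo_rel b) (@wo_rel a).

Let mul_wf a b : well_founded (@mul_rel a b).
Proof. by apply: wf_slexprod; apply: wo_wf. Qed.

Let mul_trans a b x y z :
  @mul_rel a b x y -> @mul_rel a b y z -> @mul_rel a b x z.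
Proof.
case: x y z => [x1 x2] [y1 y2] [z1 z2] xy yz.
inversion xy; inversion yz; subst.
- by apply: left_slex; apply: (@wo_trans _ _ y1).
- exact: left_slex.
- exact: left_slex.
- by apply: right_slex; apply: (@wo_trans _ _ y2).
Qed.

Let mul_total a b x y : [\/ @mul_rel a b x y, x = y | @mul_rel a b y x].
Proof.
case: x y => [x1 x2] [y1 y2].
case: (wo_total x1 y1) => [?|->|?].
- by apply: Or31; apply: left_slex.
- case: (wo_total x2 y2) => [?|->|?].
  + by apply: Or31; apply: right_slex.
  + exact: Or32.
  + by apply: Or33; apply: right_slex.
- by apply: Or33; apply: left_slex.
Qed.

Definition wo_mul a b : wellord :=
  Wellord (@mul_wf a b) (@mul_trans a b) (@mul_total a b).

End Arithmetic.

Fixpoint omega_pow (k : nat) : wellord :=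
  if k is k'.+1 then wo_mul (omega_pow k') wo_omega else wo_one.

(* omega^omega is the supremum of the omega^n for n < omega. *)
Definition lt_omega_omega (a : wellord) : Prop :=
  exists n, wo_lt a (omega_pow n).

(* x = S[b] *)
Definition elt_at0 (R : realType) (S : set R) (b : wellord) (x : R) : Prop :=
  S x /\ has_order_type (fun y z : R => y < z) (S `&` [set y | y < x]) b.

(* x = S(a); for a >= 1 *)
Definition elt_at1 (R : realType) (S : set R) (a : wellord) (x : R) : Prop :=
  exists b, wo_eq (wo_add wo_one b) a /\ elt_at0 S b x.

Section Uniqueness.
Variable R : realType.
Implicit Types (S : set R) (a b : wellord) (x y : R).

Lemma wo_irr a (i : a) : ~ wo_rel i i.
Proof. by elim: (wo_wf i) => j _ IH jj; apply: (IH j). Qed.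

Let elt_at0_le S b x y : elt_at0 S b x -> elt_at0 S b y -> x <= y.
Proof.
move=> [Sx [f [f_lt f_rg]]] [Sy [g [g_lt g_rg]]].
rewrite leNgt; apply/negP => yx.
have fP i : S (f i) /\ f i < x by have : range f (f i) by [exists i]; rewrite f_rg.
have gP i : S (g i) /\ g i < y by have : range g (g i) by [exists i]; rewrite g_rg.
have fg i : f i = g i.
  elim: (wo_wf i) => {}i _ IH.
  have [Sfi fix_] := fP i; have [Sgi giy] := gP i.
  case: (ltgtP (f i) (g i)) => // lt_i.
  - have [j _ gj] : range g (f i) by rewrite g_rg; split=> //=; apply: lt_trans giy.
    have ji : wo_rel j i by apply/g_lt; rewrite gj.
    by move: (ji); rewrite f_lt (IH _ ji) gj ltxx.
  - have [j _ fj] : range f (g i) by rewrite f_rg; split=> //=; apply: lt_trans fix_.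
    have ji : wo_rel j i by apply/f_lt; rewrite fj.
    by move: (ji); rewrite g_lt -(IH _ ji) fj ltxx.
have [j _ fj] : range f y by rewrite f_rg.
by have [_] := gP j; rewrite -fg fj ltxx.
Qed.

Lemma elt_at0_uniq S b x y : elt_at0 S b x -> elt_at0 S b y -> x = y.
Proof.
by move=> Sx Sy; apply/eqP; rewrite eq_le (elt_at0_le Sx Sy) (elt_at0_le Sy Sx).
Qed.

Lemma elt_at1_uniq S a x y : elt_at1 S a x -> elt_at1 S a y -> x = y.
Proof.
move=> [b [[f [f_lt f_rg]] Sbx]] [c [[g [g_lt g_rg]] [Sy [h [h_lt h_rg]]]]].
apply: (elt_at0_uniq Sbx); split=> //.
have f_onto z : exists i, f i = z by have [i _] : range f z by [rewrite f_rg]; exists i.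
have g_onto z : exists i, g i = z by have [i _] : range g z by [rewrite g_rg]; exists i.
have f_inj i j : f i = f j -> i = j.
  move=> fij; case: (wo_total i j) => // /f_lt; rewrite fij => H; by case: (wo_irr H).
have g_inj i j : g i = g j -> i = j.
  move=> gij; case: (wo_total i j) => // /g_lt; rewrite gij => H; by case: (wo_irr H).
have min_no d (i : wo_add wo_one d) : ~ wo_rel i (inl tt : wo_add wo_one d).
  by move=> H; inversion H.
have fg0 : f (inl tt) = g (inl tt).
  case: (wo_total (f (inl tt)) (g (inl tt))) => // H.
  - have [i gi] := g_onto (f (inl tt)); move: H; rewrite -gi => /g_lt.
    by move=> /min_no.
  - have [i fi] := f_onto (g (inl tt)); move: H; rewrite -fi => /f_lt.
    by move=> /min_no.
have ex_m (i : b) : exists j : c, g (inr j) = f (inr i).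
  have [[[]|j] gj] := g_onto (f (inr i)); last by exists j.
  by move: gj; rewrite -fg0 => /f_inj.
have [m mP] := choice ex_m.
have inr_lt (d : wellord) (i j : d) :
    @wo_rel (wo_add wo_one d) (inr i) (inr j) <-> wo_rel i j.
  by split=> [H|?]; [inversion H | constructor].
exists (h \o m); split=> [i j|].
  by rewrite /= -h_lt -inr_lt f_lt -!mP -g_lt inr_lt.
rewrite -h_rg; apply/seteqP; split=> _ [i _ <-]; first by exists (m i).
have [[[]|j] fj] := f_onto (g (inr i)); first by move: fj; rewrite fg0 => /g_inj.
exists j => //=; congr h.
by have /g_inj[] : g (inr (m j)) = g (inr i) by rewrite mP fj.
Qed.

End Uniqueness.

(* Main.v *)
(* The key is a compactness property: a sequence of numbers [n i] with bounded
   defects has a subsequence of the form [n i = a * 3 ^ k i + r i], with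
   [complexity (n i) = C + 3 * k i], with [r i] negligible compared to [3 ^ k i],
   and with [complexity a < C] unless [r i = 0]. It holds because, up to a power
   of 3, a large number of small defect is efficiently a product of two numbers,
   or the sum of a number and a bounded one, of defects smaller by a fixed amount.

   Hence a limit of defects is [C - 3 log_3 a = defect a + m] with
   [m = C - complexity a], it is approached from below only, and [m >= 1] if it is
   not attained. Conversely, call [q] stable if
   [complexity (q * 3 ^ l) = complexity q + 3 * l] for all [l]. Compactness shows
   that [q * 3 ^ k + 1] is again stable, of complexity [complexity q + 3 * k + 1],
   for all large [k], so that [defect q + 1] is a limit of stable defects; by
   iteration [defect q + m] is a limit too. So, for the closure [D u] of the set
   of defects of class [u], the left limits of [D (u + 1)] are exactly the
   [x + 1] with [x] in [D u], and between two consecutive left limits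
   [D (u + 1)] has order type omega. *)
Require Import Defs.
From Stdlib Require Import Relation_Operators Inverse_Image.
From mathcomp Require Import all_boot all_order all_algebra.
From mathcomp Require Import all_classical all_reals all_analysis.
From mathcomp Require Import zify ring lra.
Import Order.TTheory GRing.Theory Num.Theory numFieldNormedType.Exports.
Set Implicit Arguments.
Unset Strict Implicit.
Unset Printing Implicit Defensive.
Local Open Scope classical_set_scope.
Local Open Scope ring_scope.

(** * Integer complexity *)

Section Complexity.
Local Open Scope nat_scope.

Lemma value_gt0 e : 0 < value e.
Proof. by elim: e => //= e1 h1 e2 h2; rewrite ?addn_gt0 ?muln_gt0 h1 ?h2. Qed.

Lemma num_ones_gt0 e : 0 < num_ones e.
Proof. by elim: e => //= e1 h1 e2 h2; rewrite addn_gt0 h1. Qed.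

Lemma complexity_min e : complexity (value e) <= num_ones e.
Proof. by have [_] := complexityP (value_gt0 e); apply. Qed.

Lemma complexity_expr n : 0 < n ->
  exists e, value e = n /\ num_ones e = complexity n.
Proof. by move=> /complexityP[]. Qed.

Lemma complexity_gt0 n : 0 < n -> 0 < complexity n.
Proof. by move=> /complexity_expr[e [_ <-]]; exact: num_ones_gt0. Qed.

Lemma complexityD m n : 0 < m -> 0 < n ->
  complexity (m + n) <= complexity m + complexity n.
Proof.
move=> /complexity_expr[e [<- <-]] /complexity_expr[f [<- <-]].
exact: (complexity_min (Add e f)).
Qed.

Lemma complexityM m n : 0 < m -> 0 < n ->
  complexity (m * n) <= complexity m + complexity n.
Proof.
move=> /complexity_expr[e [<- <-]] /complexity_expr[f [<- <-]].
exact: (complexity_min (Mul e f)).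
Qed.

Lemma complexity1 : complexity 1 = 1.
Proof.
by apply/eqP; rewrite eqn_leq (complexity_min One) complexity_gt0.
Qed.

Lemma complexity3_le : complexity 3 <= 3.
Proof. exact: (complexity_min (Add (Add One One) One)). Qed.

Lemma complexity_mul3X n k : 0 < n ->
  complexity (n * 3 ^ k) <= complexity n + 3 * k.
Proof.
move=> n_gt0; elim: k => [|k IH]; first by rewrite !muln1 muln0 addn0.
have := complexity3_le; have := @complexityM (n * 3 ^ k) 3; rewrite muln_gt0 n_gt0 expn_gt0 expnSr.
by rewrite mulnA; lia.
Qed.

(** This is nonnegativity of the defect. A sum with both terms at least 2 reduces to a product by a
    + b <= a b; a term 1 is covered by (a + 1)^3 <= 3 a^3 for a >= 3, and by hand for smaller a. *)
Lemma value_cube_le e : value e ^ 3 <= 3 ^ num_ones e.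
Proof.
elim: e => //= e1 h1 e2 h2; last by rewrite expnMn expnD leq_mul.
have v1 := value_gt0 e1; have v2 := value_gt0 e2.
have o1 := num_ones_gt0 e1; have o2 := num_ones_gt0 e2.
move: (value e1) (value e2) (num_ones e1) (num_ones e2) v1 v2 o1 o2 h1 h2.
move=> a b x y; wlog ab : a b x y / b <= a => [wl|] a0 b0 x0 y0 ax by_.
  case: (leqP b a) => [|/ltnW] ab; first exact: wl.
  by rewrite addnC [x + y]addnC; apply: wl.
case: (ltngtP b 1) => [||b1]; first lia.
  move=> b_gt1; apply: (@leq_trans ((a * b) ^ 3)).
    by rewrite leq_exp2r //; nia.
  by rewrite expnMn expnD leq_mul.
subst b; case: (ltngtP a 2) => [||a2]; first by case: a a0 ab ax => [|[|]] // *;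
   apply: (@leq_trans (3 ^ 2)) => //; rewrite leq_exp2l //; lia.
  move=> a_gt2; apply: (@leq_trans (a ^ 3 * 3)).
    by rewrite !expnS !expn0; nia.
  by rewrite expnD leq_mul // (@leq_exp2l 3 1).
subst a; have : 1 < x by case: x ax {x0} => [|[|]].
by move=> x2; apply: (@leq_trans (3 ^ 3)) => //; rewrite leq_exp2l //; lia.
Qed.

Lemma cube_le_complexity n : n ^ 3 <= 3 ^ complexity n.
Proof.
case: (posnP n) => [->|/complexity_expr[e [<- <-]]]; first by rewrite exp0n.
exact: value_cube_le.
Qed.

Lemma complexity_ge n c : 3 ^ c < n ^ 3 -> c < complexity n.
Proof.
by move=> cn; rewrite -(@ltn_exp2l 3) // (leq_trans cn) // cube_le_complexity.
Qed.

(* The smallest positive defect is that of 2, for which [3 ^ defect = 9 / 8]. *)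
Lemma defect_gap e :
  (exists j, value e = 3 ^ j) \/ 9 * value e ^ 3 <= 8 * 3 ^ num_ones e.
Proof.
elim: e => [|e1 _ e2 _|e1 h1 e2 h2] /=; first by left; exists 0.
  have h1 := value_cube_le e1; have h2 := value_cube_le e2.
  have v1 := value_gt0 e1; have v2 := value_gt0 e2.
  have o1 := num_ones_gt0 e1; have o2 := num_ones_gt0 e2.
  move: (value e1) (value e2) (num_ones e1) (num_ones e2) v1 v2 o1 o2 h1 h2.
  move=> a b x y; wlog ab : a b x y / b <= a => [wl|] a0 b0 x0 y0 ax by_.
    case: (leqP b a) => [|/ltnW] ab; first exact: wl.
    by rewrite addnC [x + y]addnC; apply: wl.
  have small c z : 1 < c -> c ^ 3 <= 3 ^ z -> 1 < z.
    by move=> c1; case: z => [|[|z]] //; rewrite leqNgt => /negP[];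
       apply: (@leq_trans (2 ^ 3)) => //; rewrite leq_exp2r.
  have H c : 9 * (a + b) ^ 3 <= 8 * 3 ^ c -> c <= x + y ->
      9 * (a + b) ^ 3 <= 8 * 3 ^ (x + y).
    by move=> Hc cxy; apply: (leq_trans Hc); rewrite leq_mul2l leq_exp2l.
  case: (ltngtP b 1) => [||b1]; first lia.
    move=> b_gt1; right; have a_gt1 := leq_trans b_gt1 ab.
    case: (ltngtP a 2) => [|a_gt2|a2]; first lia.
      apply: (@leq_trans (8 * (a * b) ^ 3)); last first.
        by rewrite expnMn expnD leq_mul2l leq_mul.
      have {}H : 6 * (a + b) <= 5 * (a * b) by nia.
      have : (6 * (a + b)) ^ 3 <= (5 * (a * b)) ^ 3 by rewrite leq_exp2r.
      by rewrite !(expnMn 5) !(expnMn 6); lia.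
    have b2 : b = 2 by lia.
    subst a b; apply: (H 4) => //.
    by have := small _ _ a_gt1 ax; have := small _ _ b_gt1 by_; lia.
  (* The sum 2 + 1 is a power of 3, and 1 + 1 attains the bound with equality. *)
  subst b; case: (ltngtP a 2) => [a_lt2|a_gt2|->]; last by left; exists 1.
    by right; have a1 : a = 1 by [lia]; subst a; apply: (H 2) => //; lia.
  right; apply: (@leq_trans (8 * (a ^ 3 * 3))).
    have {}H : 3 * (a + 1) <= 4 * a by lia.
    have : (3 * (a + 1)) ^ 3 <= (4 * a) ^ 3 by rewrite leq_exp2r.
    by rewrite (expnMn 3) (expnMn 4); lia.
  by rewrite expnD leq_mul2l leq_mul // (@leq_exp2l 3 1).
have c1 := value_cube_le e1; have c2 := value_cube_le e2.
rewrite expnD expnMn.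
case: h1 => [[i v1]|h1]; last by right; rewrite mulnA [leqRHS]mulnA; apply: leq_mul.
case: h2 => [[j v2]|h2]; last by right; rewrite mulnCA [leqRHS]mulnCA; apply: leq_mul.
by left; exists (i + j); rewrite expnD v1 v2.
Qed.

(** * Decomposition of numbers of small defect *)

(* The defect of [n] is less than [N] times the smallest positive defect. *)
Definition small_defect N n := 8 ^ N * 3 ^ complexity n < 9 ^ N * n ^ 3.

Lemma small_defect_gt0 N n : small_defect N n -> 0 < n.
Proof. by case: n => //; rewrite /small_defect exp0n // muln0. Qed.

(** A shorter expression for either summand would shorten the whole. *)
Lemma complexity_split_add e1 e2 :
  num_ones (Add e1 e2) = complexity (value (Add e1 e2)) ->
  num_ones e1 = complexity (value e1) /\ num_ones e2 = complexity (value e2).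
Proof.
have := complexity_min e1; have := complexity_min e2.
have := complexityD (value_gt0 e1) (value_gt0 e2) => /=; lia.
Qed.

Lemma complexity_split_mul e1 e2 :
  num_ones (Mul e1 e2) = complexity (value (Mul e1 e2)) ->
  num_ones e1 = complexity (value e1) /\ num_ones e2 = complexity (value e2).
Proof.
have := complexity_min e1; have := complexity_min e2.
have := complexityM (value_gt0 e1) (value_gt0 e2) => /=; lia.
Qed.

(** The bound in [Bounded] comes from sums a + b with b <= 9^(N+1) and a < 3 b. *)
Variant decomposition N m : Prop :=
| Bounded of m <= 4 * 9 ^ N.+1
| Product a b of m = a * b & complexity m = complexity a + complexity b
    & small_defect N a & small_defect N b
| Sum a b of m = a + b & complexity m = complexity a + complexity b
    & small_defect N a & 0 < b & b <= 9 ^ N.+1.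

Lemma complexity3X j : 0 < j -> complexity (3 ^ j) = 3 * j.
Proof.
case: j => // j _; apply/eqP; rewrite eqn_leq; apply/andP; split.
  have := @complexity_mul3X 3 j erefl; rewrite -expnS.
  by have := complexity3_le; lia.
by rewrite -(@leq_exp2l 3) // mulnC expnM cube_le_complexity.
Qed.

(** The cases follow the outermost operation of a shortest expression. Factors that are powers of 3
    are split off by induction; any other factor has at least the smallest positive defect, which
    leaves less than [N] times that for its cofactor. *)
Lemma decompose N n : small_defect N.+1 n ->
  exists j m, [/\ n = m * 3 ^ j, complexity n = complexity m + 3 * j
                & decomposition N m].
Proof.
have [p] := ubnP n; elim: p n => // p IH n le_np sn.
have [e [en eo]] := complexity_expr (small_defect_gt0 sn).
case: e en eo => [|e1 e2|e1 e2] en eo.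
- exists 0, n; rewrite muln1 muln0 addn0; split=> //; apply: Bounded.
  by rewrite -en /= muln_gt0 expn_gt0.
- exists 0, n; rewrite muln1 muln0 addn0; split=> //.
  have [e1o e2o] : num_ones e1 = complexity (value e1) /\ num_ones e2 = complexity (value e2).
    by apply: complexity_split_add; rewrite en.
  move: en eo; rewrite /= e1o e2o.
  have := value_gt0 e1; have := value_gt0 e2; move: (value e1) (value e2) => a b.
  move=> {e1 e2 e1o e2o IH}.
  wlog ab : a b / b <= a => [wl|] b0 a0 abn cabn.
    case: (leqP b a) => [|/ltnW] ab; first exact: (wl a b).
    by apply: (wl b a) => //; rewrite addnC.
  have ca := cube_le_complexity a; have cb := cube_le_complexity b.
  move: (sn); rewrite /small_defect -cabn -abn expnD => sab.
  (* By (a + b)^3 <= 8 a^3 and a^3 <= 3^||a||, the assumption leaves 8^N 3^||b|| < 9^(N+1). *)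
  have b_small : b <= 9 ^ N.+1.
    have b3 : b <= b ^ 3 by rewrite -{1}(expn1 b) leq_pexp2l.
    apply: (leq_trans b3); apply: (leq_trans cb).
    have h8 : 0 < 8 ^ N by rewrite expn_gt0.
    have ab3 : (a + b) ^ 3 <= 8 * a ^ 3.
      by apply: (@leq_trans ((2 * a) ^ 3)); rewrite ?leq_exp2r ?expnMn //; lia.
    have a3 : 0 < a ^ 3 by rewrite expn_gt0 a0.
    rewrite expnS in sab.
    have h1 : 8 * (8 ^ N * (a ^ 3 * 3 ^ complexity b)) < 8 * (9 ^ N.+1 * a ^ 3).
      apply: (@leq_trans (9 ^ N.+1 * (a + b) ^ 3)); last first.
        by rewrite mulnCA leq_mul2l ab3 orbT.
      apply: leq_trans sab; rewrite ltnS mulnA.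
      by rewrite leq_mul2l leq_mul2r ca !orbT.
    rewrite ltn_mul2l /= mulnCA [X in _ < X]mulnC ltn_mul2l in h1.
    case/andP: h1 => _ /ltnW; apply: leq_trans.
    by rewrite -{1}[3 ^ _]mul1n leq_mul2r h8 orbT.
  case: (leqP (3 * b) a) => [ab3|ab3]; last by apply: Bounded; lia.
  apply: (@Sum _ _ a b) => //; first by rewrite abn cabn.
  have b1 : 3 <= 3 ^ complexity b by rewrite (@leq_exp2l 3 1) // complexity_gt0.
  (* Passing from a + b to a divides 3^complexity by at least 3 and the cube by at most 24/9, so
     their quotient shrinks by the factor 8/9 that takes [N.+1] to [N]. *)
  have h : 9 * (a + b) ^ 3 <= 24 * a ^ 3.
    have {}H : 3 * (a + b) <= 4 * a by lia.
    have : (3 * (a + b)) ^ 3 <= (4 * a) ^ 3 by rewrite leq_exp2r.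
    by rewrite (expnMn 3) (expnMn 4); lia.
  rewrite /small_defect -(@ltn_pmul2l 24) //.
  apply: (@leq_ltn_trans (8 ^ N.+1 * (3 ^ complexity a * 3 ^ complexity b))).
    rewrite expnS -!mulnA mulnCA [X in _ <= X]mulnCA !mulnA [24]/(8 * 3)%N -!mulnA.
    nia.
  apply: (leq_trans sab).
  rewrite (expnS 9) (mulnC 9) -mulnA (mulnCA 24) leq_mul2l.
  by rewrite h orbT.
have [e1o e2o] : num_ones e1 = complexity (value e1) /\ num_ones e2 = complexity (value e2).
  by apply: complexity_split_mul; rewrite en.
(* A factor 1 cannot occur in a shortest expression. A factor 3^(j+1) has defect 0, so its cofactor
   inherits the small defect and is smaller than [n]. *)
have pow3 a b j : a = 3 ^ j -> n = a * b -> 0 < b ->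
    complexity n = complexity a + complexity b ->
    exists j m, [/\ n = m * 3 ^ j, complexity n = complexity m + 3 * j
                & decomposition N m].
  case: j => [->|j aj nab b0 cab].
    by rewrite mul1n complexity1 => <-; lia.
  rewrite aj complexity3X // in cab.
  have [|//|i [m [bm cbm dm]]] := IH b.
  - have : b < n by rewrite nab aj ltn_Pmull // (@ltn_exp2l 3 0).
    lia.
  - move: sn; rewrite /small_defect cab nab aj expnMn expnD expnM.
    rewrite (expnAC 3 3) mulnCA [X in _ < X]mulnCA ltn_mul2l => /andP[_].
    exact.
  - exists (i + j.+1), m; split=> //; last by rewrite cab cbm; lia.
    by rewrite nab aj bm expnD mulnCA (mulnC (3 ^ j.+1)).
have v1 := value_gt0 e1; have v2 := value_gt0 e2.
have cn : complexity n = complexity (value e1) + complexity (value e2).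
  by rewrite -eo /= e1o e2o.
case: (defect_gap e1) => [[j h]|h1].
  exact: (pow3 _ (value e2) _ h).
case: (defect_gap e2) => [[j h]|h2].
  by apply: (pow3 _ (value e1) _ h) => //; [rewrite -en /= mulnC | rewrite cn addnC].
exists 0, n; rewrite muln1 muln0 addn0; split=> //.
rewrite e1o in h1; rewrite e2o in h2.
move: sn; rewrite /small_defect cn -en /= expnD expnMn => sn.
have c1 := cube_le_complexity (value e1); have c2 := cube_le_complexity (value e2).
have cancel N' x y x3 y3 : 9 * x3 <= 8 * x -> 0 < x3 ->
   8 ^ N'.+1 * (x * y) < 9 ^ N'.+1 * (x3 * y3) -> 8 ^ N' * y < 9 ^ N' * y3.
  move=> hx x30; rewrite !expnS => h.
  rewrite -(@ltn_pmul2l (9 * x3)); last by rewrite muln_gt0.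
  apply: (@leq_ltn_trans (8 * x * (8 ^ N' * y))); first by rewrite leq_mul2r hx orbT.
  by move: h; congr (_ < _); nia.
apply: (@Product _ _ (value e1) (value e2)); rewrite -?en -?cn -?en //.
  apply: (cancel _ _ _ _ _ h2); first by rewrite expn_gt0 v2.
  by rewrite [3 ^ _ * _]mulnC [value e2 ^ 3 * _]mulnC.
by apply: (cancel _ _ _ _ _ h1); first by rewrite expn_gt0 v1.
Qed.

(** * Sequences of bounded defect *)

Definition increasing (phi : nat -> nat) := forall i j, i < j -> phi i < phi j.

Definition frequently (P : nat -> Prop) := forall m, exists2 i, m <= i & P i.

Lemma increasing_ge phi i : increasing phi -> i <= phi i.
Proof.
by move=> phi_inc; elim: i => // i /leq_ltn_trans; apply; apply: phi_inc.
Qed.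

Lemma frequently_subseq P : frequently P ->
  exists2 phi, increasing phi & forall i, P (phi i).
Proof.
move=> freqP.
have [m|g gP] := @choice _ _ (fun m i => m <= i /\ P i).
  by have [i] := freqP m; exists i.
pose phi := fix phi i := if i is i'.+1 then g (phi i').+1 else g 0.
have phiS i : phi i < phi i.+1 by have [] := gP (phi i).+1.
exists phi; last first.
  by case=> [|i] /=; [case: (gP 0) | case: (gP (phi i).+1)].
move=> i j; elim: j => // j IH; rewrite ltnS leq_eqVlt => /orP[/eqP->//|/IH].
by move=> /ltn_trans; apply.
Qed.

Lemma frequently_or P Q : (forall i, P i \/ Q i) -> frequently P \/ frequently Q.
Proof.
move=> PQ; apply: contrapT => /not_orP[/existsNP[p nP] /existsNP[q nQ]].
case: (PQ (maxn p q)) => H; [apply: nP | apply: nQ].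
  by exists (maxn p q) => //; rewrite leq_maxl.
by exists (maxn p q) => //; rewrite leq_maxr.
Qed.

Lemma frequently_orW P Q : frequently (fun i => P i \/ Q i) ->
  frequently P \/ frequently Q.
Proof.
move=> /frequently_subseq[phi phi_inc] /frequently_or[] H; [left|right];
  move=> m; have [i mi Pi] := H m; exists (phi i) => //;
  exact: (leq_trans mi (increasing_ge _ phi_inc)).
Qed.

Lemma frequently_const (n : nat -> nat) B : frequently (fun i => n i <= B) ->
  exists v, frequently (fun i => n i = v).
Proof.
elim: B => [|B IH] freq.
  by exists 0 => m; have [i mi] := freq m; rewrite leqn0 => /eqP; exists i.
case: (@frequently_orW (fun i => n i <= B) (fun i => n i = B.+1)) => [m||].
- have [i mi] := freq m; rewrite leq_eqVlt ltnS => /orP[/eqP|] H; exists i => //.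
    by right.
  by left.
- exact: IH.
- by exists B.+1.
Qed.

(* The [n i] are asymptotic to [a * 3 ^ k i], while their defects tend to
   [C - 3 log_3 a], which exceeds the defect of [a] by at least 1 unless all
   [r i] vanish. *)
Definition asymptotic (n : nat -> nat) a C (k r : nat -> nat) :=
  [/\ 0 < a,
      forall i, n i = a * 3 ^ k i + r i,
      forall i, complexity (n i) = C + 3 * k i,
      forall i, complexity a + (0 < r i) <= C
    & forall A, exists i0, forall i, i0 <= i -> A * r i < 3 ^ k i].

Definition has_asymptotics (n : nat -> nat) :=
  exists2 phi, increasing phi & exists a C k r, asymptotic (n \o phi) a C k r.

Lemma asymptotic_subseq n a C k r phi : increasing phi ->
  asymptotic n a C k r -> asymptotic (n \o phi) a C (k \o phi) (r \o phi).
Proof.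
move=> phi_inc [a0 nE cE aC small]; split=> // [i|i|i|A] /=; rewrite -?nE -?cE//.
have [i0 i0P] := small A; exists i0 => i i0i; apply: i0P.
exact: (leq_trans i0i (increasing_ge _ phi_inc)).
Qed.

Lemma increasing_comp phi psi :
  increasing phi -> increasing psi -> increasing (phi \o psi).
Proof. by move=> h1 h2 i j ij; apply/h1/h2. Qed.

Lemma has_asymptotics_subseq n phi : increasing phi ->
  has_asymptotics (n \o phi) -> has_asymptotics n.
Proof.
move=> phi_inc [psi psi_inc asy]; exists (phi \o psi) => //.
exact: increasing_comp.
Qed.

Lemma has_asymptotics_frequently_bounded n B :
  (forall i, 0 < n i) -> frequently (fun i => n i <= B) -> has_asymptotics n.
Proof.
move=> n_gt0 /frequently_const[v /frequently_subseq[phi phi_inc nv]].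
exists phi => //; exists v, (complexity v), (fun=> 0), (fun=> 0); split=> //.
- by rewrite -(nv 0).
- by move=> i /=; rewrite nv muln1 addn0.
- by move=> i /=; rewrite nv muln0 addn0.
- by move=> i; rewrite addn0.
- by move=> A; exists 0 => i _; rewrite muln0.
Qed.

Lemma has_asymptotics_mul3X n m j : (forall i, n i = m i * 3 ^ j i) ->
  (forall i, complexity (n i) = complexity (m i) + 3 * j i) ->
  has_asymptotics m -> has_asymptotics n.
Proof.
move=> nE cE [phi phi_inc [a [C [k [r [a0 mE cmE aC small]]]]]].
exists phi => //; exists a, C, (fun i => k i + j (phi i)), (fun i => r i * 3 ^ j (phi i)).
split=> // [i|i|i|A] /=.
- by rewrite nE [m _]mE mulnDl expnD mulnA.
- by rewrite cE [complexity _]cmE mulnDr addnA.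
- by rewrite muln_gt0 expn_gt0 /= andbT.
- have [i0 i0P] := small A; exists i0 => i /i0P.
  by rewrite mulnA expnD ltn_mul2r expn_gt0.
Qed.

(** All subsequences of [m2] are needed because its asymptotics are extracted after passing to the
    subsequence that serves [m1]. *)
Lemma has_asymptotics_mul n m1 m2 : (forall i, n i = m1 i * m2 i) ->
  (forall i, complexity (n i) = complexity (m1 i) + complexity (m2 i)) ->
  has_asymptotics m1 ->
  (forall phi, increasing phi -> has_asymptotics (m2 \o phi)) ->
  has_asymptotics n.
Proof.
move=> nE cE [phi phi_inc [a [C [k [r asy1]]]]] /(_ _ phi_inc).
move=> [psi psi_inc [b [D [l [s [b0 m2E cm2E bD small2]]]]]].
have [a0 m1E cm1E aC small1] := asymptotic_subseq psi_inc asy1.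
exists (phi \o psi); first exact: increasing_comp.
move: (k \o psi) (r \o psi) m1E cm1E aC small1 => {asy1}k {}r m1E cm1E aC small1.
exists (a * b), (C + D), (fun i => k i + l i),
  (fun i => a * 3 ^ k i * s i + b * 3 ^ l i * r i + r i * s i); split.
- by rewrite muln_gt0 a0.
- move=> i /=; move: (m1E i) (m2E i) => /= e1 e2; rewrite nE e1 e2 expnD; nia.
- by move=> i /=; move: (cm1E i) (cm2E i) => /= e1 e2; rewrite cE e1 e2; lia.
- move=> i; have := complexityM a0 b0; have := aC i; have := bD i.
  case: (posnP (r i)) => [->|r0]; case: (posnP (s i)) => [->|s0];
    rewrite ?muln0 /=; lia.
(* The factors 3 keep [A] times each of the three parts of the remainder within a third of
   3^(k+l). *)
- move=> A; have [i1 i1P] := small1 (3 * A.+1 * b.+1).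
  have [i2 i2P] := small2 (3 * A.+1 * a.+1); exists (maxn i1 i2) => i.
  rewrite geq_max expnD => /andP[/i1P + /i2P].
  move: (3 ^ k i) (3 ^ l i) (r i) (s i) => K L x y h1 h2.
  have g1 : 3 * A * (b * x) * L <= K * L by rewrite leq_mul2r; apply/orP; right; nia.
  have g2 : 3 * A * (a * y) * K <= L * K by rewrite leq_mul2r; apply/orP; right; nia.
  have g3 : (3 * A.+1 * x) * y.+1 <= K * L by apply: leq_mul; nia.
  have K0 : 0 < K * L by rewrite muln_gt0; apply/andP; split; lia.
  nia.
Qed.

(** By pigeonhole [b] may be taken constant. It joins the remainder, and its complexity, at least 1,
    pays for the remainder being nonzero. *)
Lemma has_asymptotics_add n m b B : (forall i, n i = m i + b i) ->
  (forall i, complexity (n i) = complexity (m i) + complexity (b i)) ->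
  (forall i, 0 < b i <= B) ->
  (forall phi, increasing phi -> has_asymptotics (m \o phi)) ->
  has_asymptotics n.
Proof.
move=> nE cE bB asy.
have [|v /frequently_subseq[phi0 phi0_inc bv]] := @frequently_const b B.
  by move=> i; exists i => //; case/andP: (bB i).
have v0 : 0 < v by rewrite -(bv 0); case/andP: (bB (phi0 0)).
have [phi phi_inc [a [C [k [r [a0 mE cmE aC small]]]]]] := asy _ phi0_inc.
have psi_inc := increasing_comp phi0_inc phi_inc.
have bE i : b (phi0 (phi i)) = v := bv _.
pose m' := n \o (phi0 \o phi).
have n_gt0 i : 0 < n i by rewrite nE addn_gt0 orbC; case/andP: (bB i) => ->.
(* A constant is negligible only if 3^k tends to infinity; if bounded values recur, a constant
   subsequence serves instead. *)
have [[B' freq]|nfreq] := pselect (exists B', frequently (fun i => m' i <= B')).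
  apply: (has_asymptotics_subseq psi_inc).
  by apply: (has_asymptotics_frequently_bounded _ freq) => i; apply: n_gt0.
exists (phi0 \o phi) => //.
exists a, (C + complexity v), k, (fun i => r i + v); split=> // [i|i|i|A] /=.
- by rewrite nE bE [m _]mE addnA.
- by rewrite cE bE [complexity (m _)]cmE addnAC.
- have := complexity_gt0 v0; have := aC i; lia.
have [i1 i1P] := small (2 * A.+1).
have : exists i0, forall i, i0 <= i -> (a + 1) * (2 * A * v) + v < m' i.
  apply: contrapT => H; apply: nfreq; exists ((a + 1) * (2 * A * v) + v).
  move=> i0; apply: contrapT => G; apply: H; exists i0 => i i0i.
  by rewrite ltnNge; apply/negP => H; apply: G; exists i.
move=> [i2 i2P]; exists (maxn i1 i2) => i.
rewrite geq_max => /andP[/i1P h1 /i2P].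
rewrite /m' /= nE bE ltn_add2r [m _]mE.
move: (3 ^ k i) (r i) h1 => K x h1 h2.
have h : 2 * A * v < K by apply: contraTT h2; rewrite -!leqNgt => h2; nia.
nia.
Qed.

(** Induction on [N]: one of the cases of [decomposition] occurs infinitely often, and its parts are
    bounded or small for the previous [N]. For [N = 0] no number qualifies. *)
Lemma has_asymptotics_of_small_defect N n :
  (forall i, small_defect N (n i)) -> has_asymptotics n.
Proof.
elim: N n => [|N IH] n sn.
  have := sn 0; rewrite /small_defect !mul1n ltnNge.
  by rewrite cube_le_complexity.
have [j jP] := choice (fun i => decompose (sn i)).
have {jP} [m mP] := choice jP.
have m_gt0 i : 0 < m i.
  have [nm _ _] := mP i; have := small_defect_gt0 (sn i).
  by rewrite nm muln_gt0 => /andP[].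
apply: (@has_asymptotics_mul3X n m j) => [i|i|]; try by have [] := mP i.
have {}mP i : decomposition N (m i) by have [] := mP i.
pose bounded i := m i <= 4 * 9 ^ N.+1.
pose product i := exists ab : nat * nat,
  [/\ m i = ab.1 * ab.2, complexity (m i) = complexity ab.1 + complexity ab.2,
      small_defect N ab.1 & small_defect N ab.2].
pose sum i := exists ab : nat * nat,
  [/\ m i = ab.1 + ab.2, complexity (m i) = complexity ab.1 + complexity ab.2,
      small_defect N ab.1 & 0 < ab.2 <= 9 ^ N.+1].
have cases i : bounded i \/ (product i \/ sum i).
  case: (mP i) => [h|a b *|a b ? ? ? b0 bB]; [by left | right; left | right; right].
    by exists (a, b).
  by exists (a, b); split=> //=; rewrite b0.
case: (frequently_or cases) => [|/frequently_orW[]].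
- exact: has_asymptotics_frequently_bounded.
- move=> /frequently_subseq[phi phi_inc /choice[ab abP]].
  apply: (has_asymptotics_subseq phi_inc).
  apply: (@has_asymptotics_mul _ (fst \o ab) (snd \o ab)) => [i|i||psi _] /=.
  + by have [] := abP i.
  + by have [] := abP i.
  + by apply: IH => i; have [] := abP i.
  + by apply: IH => i; have [] := abP (psi i).
- move=> /frequently_subseq[phi phi_inc /choice[ab abP]].
  apply: (has_asymptotics_subseq phi_inc).
  apply: (@has_asymptotics_add _ (fst \o ab) (snd \o ab) (9 ^ N.+1)) => [i|i|i|psi _] /=.
  + by have [] := abP i.
  + by have [] := abP i.
  + by have [] := abP i.
  + by apply: IH => i; have [] := abP (psi i).
Qed.

Lemma bernoulli_9_8 N : 8 ^ N * (8 + N) <= 9 ^ N * 8.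
Proof.
elim: N => // N IH; rewrite !expnS; apply: (@leq_trans (9 * (8 ^ N * (8 + N)))).
  move: (8 ^ N) => X; nia.
by rewrite -mulnA leq_mul2l.
Qed.

(** For N = 8 M, Bernoulli's inequality gives (9/8)^N >= M + 1, so every bound on the defect is a
    [small_defect] bound. *)
Lemma has_asymptotics_of_bounded M n :
  (forall i, 0 < n i /\ 3 ^ complexity (n i) <= M * n i ^ 3) -> has_asymptotics n.
Proof.
move=> nM; apply: (@has_asymptotics_of_small_defect (8 * M)) => i.
have [n0 le_M] := nM i; rewrite /small_defect.
have n3 : 0 < n i ^ 3 by rewrite expn_gt0 n0.
have := bernoulli_9_8 (8 * M); have : 0 < 8 ^ (8 * M) by rewrite expn_gt0.
move: (8 ^ _) (9 ^ _) (n i ^ 3) (3 ^ _) n3 le_M => X Y Z W Z0 WM X0 XY.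
have XY' : X * M.+1 <= Y by nia.
apply: (@leq_ltn_trans (X * (M * Z))); first by rewrite leq_mul2l WM orbT.
apply: (@leq_trans (X * M.+1 * Z)); last by rewrite leq_mul2r XY' orbT.
by rewrite mulnA ltn_mul2r Z0 ltn_mul2l X0 /=.
Qed.

(** * Stable numbers *)

Definition stable q := forall l, complexity (q * 3 ^ l) = complexity q + 3 * l.

(** Multiplication by 3 costs at most 3, so [d] never increases and stays constant after reaching
    its minimum. The exponent is positive so that the stable number exceeds 1 even for [n = 1]. *)
Lemma stable_exists n : 0 < n -> exists K, stable (n * 3 ^ K.+1).
Proof.
move=> n_gt0; pose d K := complexity (n * 3 ^ K) - 3 * K.
have cK K : 3 * K <= complexity (n * 3 ^ K).
  rewrite -(@leq_exp2l 3) // mulnC expnM; apply: leq_trans (cube_le_complexity _).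
  by rewrite leq_exp2r // leq_pmull.
have exd : exists c, `[< exists K, d K = c >] by exists (d 0); apply/asboolP; exists 0.
case: (ex_minnP exd) => c /asboolP[K dK] c_min.
have ge_c i : c <= d (K + i) by apply: c_min; apply/asboolP; exists (K + i).
have cE i : complexity (n * 3 ^ (K + i)) = complexity (n * 3 ^ K) + 3 * i.
  have := ge_c i; rewrite -dK /d; have := cK (K + i); have := cK K.
  have := @complexity_mul3X (n * 3 ^ K) i; rewrite muln_gt0 n_gt0 expn_gt0 /=.
  by rewrite -mulnA -expnD; lia.
exists K => l; have := cE 1; have := cE (1 + l).
by rewrite addnA addn1 expnD mulnA => -> ->; lia.
Qed.

(** For s <= t both leading terms are multiples of 3^s, so distinct ones differ by at least 3^s,
    more than the remainders can make up. *)
Lemma leading_term_eq q s y a t r : 0 < a -> 0 < q -> (q + a + 1) * y < 3 ^ s ->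
  (q + a + 1) * r < 3 ^ t -> q * 3 ^ s + y = a * 3 ^ t + r -> q * 3 ^ s = a * 3 ^ t.
Proof.
wlog st : q s y a t r / s <= t => [wl|].
  case: (leqP s t) => [|/ltnW] st; first exact: wl.
  move=> a0 q0 h1 h2 e; symmetry; apply: (wl a t r q s y) => //.
    by rewrite (addnC a).
  by rewrite (addnC a).
rewrite -(subnKC st) expnD; move: (t - s) => d.
have : 0 < 3 ^ s by rewrite expn_gt0.
have : 0 < 3 ^ d by rewrite expn_gt0.
move: (3 ^ s) (3 ^ d) => X Y Y0 X0 a0 q0 hy hr e.
have y_lt : y < X by nia.
case: (ltngtP q (a * Y)) => [lt_q|gt_q|->]; last by rewrite mulnA mulnAC.
  have : (q + 1) * X <= a * Y * X by rewrite leq_mul2r; apply/orP; right; lia.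
  by rewrite mulnDl => H; exfalso; nia.
(* Here [Y <= q], which turns the bound on [r] relative to [X * Y] into one relative to [X]. *)
have r_lt : r < X.
  rewrite ltnNge; apply/negP => Xr.
  have : Y <= q by nia.
  nia.
have : (a * Y + 1) * X <= q * X by rewrite leq_mul2r; apply/orP; right; lia.
by rewrite mulnDl => H; exfalso; nia.
Qed.

(* If infinitely many [q * 3 ^ k + 1] had smaller complexity, then the asymptotics
   of a subsequence would give [a] with [a * 3 ^ t = q * 3 ^ s] and
   [complexity a + 3 * t < complexity q + 3 * s], against the stability of [q]. *)
Lemma stable_succ q : 0 < q -> stable q -> exists k0, forall k, k0 <= k ->
  forall l, complexity ((q * 3 ^ k + 1) * 3 ^ l) = complexity q + 3 * k + 1 + 3 * l.
Proof.
move=> q_gt0 q_st; apply: contrapT => H.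
pose drop k := exists l,
  complexity ((q * 3 ^ k + 1) * 3 ^ l) <= complexity q + 3 * k + 3 * l.
have freq : frequently drop.
  move=> m; apply: contrapT => Hm; apply: H; exists m => k mk l.
  apply/eqP; rewrite eqn_leq; apply/andP; split.
    apply: (leq_trans (complexity_mul3X _ _)); first by rewrite addn1.
    rewrite leq_add2r; apply: (leq_trans (complexityD _ _)) => //.
      by rewrite muln_gt0 q_gt0 expn_gt0.
    by rewrite complexity1 leq_add2r complexity_mul3X.
  rewrite addn1 addSn ltnNge; apply/negP => le_c; apply: Hm; exists k => //.
  by exists l.
have [phi phi_inc /choice[l lP]] := frequently_subseq freq.
pose n i := (q * 3 ^ phi i + 1) * 3 ^ l i.
have [|psi psi_inc [a [C [k [r [a0 nE cE aC small]]]]]] :=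
    @has_asymptotics_of_bounded (3 ^ complexity q) n.
  (* The drop bounds 3^||n|| by 3^||q|| times the cube of 3^(phi+l), and n >= 3^(phi+l). *)
  move=> i; split; first by rewrite muln_gt0 expn_gt0 addn1.
  apply: (@leq_trans (3 ^ (complexity q + 3 * phi i + 3 * l i))).
    by rewrite leq_exp2l //; exact: lP.
  rewrite -addnA expnD leq_mul2l -mulnDr mulnC expnM leq_exp2r //.
  by rewrite expnD leq_mul2r; apply/orP; right; nia.
have [i0 i0P] := small (q + a + 1).
pose i := maxn i0 (q + a + 1).
have /i0P r_small : i0 <= i by rewrite leq_maxl.
move: (nE i) (cE i) (aC i) (lP (psi i)) r_small => /=; rewrite /n /=.
have : q + a + 1 <= phi (psi i).
  apply: (@leq_trans i); first by rewrite leq_maxr.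
  exact: (increasing_ge _ (increasing_comp phi_inc psi_inc)).
move: (phi (psi i)) (l (psi i)) (k i) (r i) => f g t x fA nxE cxE xC le_c x_small.
have e : q * 3 ^ (f + g) = a * 3 ^ t.
  apply: (@leading_term_eq _ _ (3 ^ g) _ _ x) => //; last first.
    by rewrite -nxE expnD mulnDl mulnA mul1n.
  rewrite expnD ltn_mul2r expn_gt0 /=; apply: (leq_ltn_trans fA).
  exact: ltn_expl.
(* The leading terms cancel and leave x = 3^g, whence ||a|| < C. *)
have x_gt0 : 0 < x.
  rewrite lt0n; apply/eqP => x0; move: nxE.
  by rewrite x0 addn0 -e expnD mulnDl mulnA => /eqP; rewrite -{2}[_ * 3 ^ g]addn0 eqn_add2l mul1n expn_eq0.
have := complexity_mul3X t a0; rewrite -e q_st.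
by move: xC le_c; rewrite x_gt0 cxE; lia.
Qed.

End Complexity.

(** * Limits of defects *)

Section Defects.
Variable R : realType.
Implicit Types (u : 'Z_3) (x z e : R).

Definition log3_cube (n : nat) : R := 3 * (ln n%:R / ln 3).

Lemma ln3_gt0 : 0 < ln (3 : R).
Proof. by rewrite ln_gt0 // ltr1n. Qed.

Lemma log3_cube_mul3X n k : (0 < n)%N ->
  log3_cube (n * 3 ^ k) = log3_cube n + 3 * k%:R.
Proof.
move=> n_gt0; rewrite /log3_cube natrM natrX lnM ?posrE ?exprn_gt0 ?ltr0n //.
rewrite lnXn // -(mulr_natr (ln 3)); field.
by rewrite gt_eqF // ln3_gt0.
Qed.

Lemma defect_ge0 n : 0 <= defect R n.
Proof.
case: (posnP n) => [->|n_gt0]; first by rewrite /defect ln0 // mul0r mulr0 subr0.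
rewrite /defect subr_ge0 mulrA ler_pdivrMr ?ln3_gt0 // !mulr_natl -!lnXn ?ltr0n //.
by rewrite ler_ln ?posrE ?exprn_gt0 ?ltr0n // -!natrX ler_nat cube_le_complexity.
Qed.

Lemma defect_le_bounded n B : (0 < n)%N -> defect R n <= B%:R ->
  (3 ^ complexity n <= 3 ^ B * n ^ 3)%N.
Proof.
move=> n_gt0; rewrite /defect lerBlDr -lerBlDl mulrA ler_pdivlMr ?ln3_gt0 //.
rewrite mulrBl lerBlDl !mulr_natl -!lnXn ?ltr0n // -lnM ?posrE ?exprn_gt0 ?ltr0n //.
by rewrite ler_ln ?posrE ?mulr_gt0 ?exprn_gt0 ?ltr0n // -!natrX -natrM ler_nat.
Qed.

(** With x = r / (a 3^k), the defect is z - 3 log_3 (1 + x), and 0 <= ln (1 + x) <= x <= r / 3^k. *)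
Lemma defect_leading_term n a k r C :
  (0 < a)%N -> n = (a * 3 ^ k + r)%N -> complexity n = (C + 3 * k)%N ->
  let z := C%:R - log3_cube a in
  [/\ defect R n <= z, (0 < r)%N -> defect R n < z
    & z - 3 / ln 3 * (r%:R / 3 ^+ k) <= defect R n].
Proof.
move=> a_gt0 nE cE z; pose x : R := r%:R / (a * 3 ^ k)%:R.
have m_gt0 : (0 < a * 3 ^ k)%N by rewrite muln_gt0 a_gt0 expn_gt0.
have m_gt0R : 0 < (a * 3 ^ k)%:R :> R by rewrite ltr0n.
have x_ge0 : 0 <= x by rewrite divr_ge0.
have c_gt0 : 0 < 3 / ln 3 :> R by rewrite divr_gt0 // ln3_gt0.
have dE : defect R n = z - 3 / ln 3 * ln (1 + x).
  rewrite /defect; have -> : n%:R = (a * 3 ^ k)%:R * (1 + x) :> R.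
    by rewrite mulrDr mulr1 mulrC divfK ?gt_eqF // -natrD -nE.
  have := log3_cube_mul3X k a_gt0; rewrite /z /log3_cube.
  rewrite lnM ?posrE ?ltr_wpDr // cE (natrD _ C) (natrM _ 3) => h.
  set l := ln (1 + x); have -> : 3 * ((ln (a * 3 ^ k)%:R + l) / ln 3) =
      3 * (ln (a * 3 ^ k)%:R / ln 3) + 3 / ln 3 * l by ring.
  by rewrite h; ring.
rewrite dE; split=> [|r_gt0|].
- by rewrite gerBl mulr_ge0 ?(ltW c_gt0) // ln_ge0 // lerDl.
- by rewrite gtrBl mulr_gt0 // ln_gt0 // ltrDl divr_gt0 // ltr0n.
- rewrite lerD2l lerN2 ler_pM2l //.
  apply: (@le_trans _ _ x); first by rewrite le_ln1Dx // (lt_le_trans _ x_ge0).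
  rewrite ler_wpM2l // -natrX lef_pV2 ?posrE ?ltr0n ?expn_gt0 // ler_nat.
  by rewrite leq_pmull.
Qed.

(** With the upper bound in [defect_leading_term], this is convergence of the defects. *)
Lemma asymptotic_defect n a C k r : asymptotic n a C k r ->
  forall e, 0 < e -> exists i0, forall i, (i0 <= i)%N ->
  C%:R - log3_cube a - e < defect R (n i).
Proof.
move=> [a_gt0 nE cE aC small] e e_gt0.
have c_gt0 : 0 < 3 / ln 3 :> R by rewrite divr_gt0 // ln3_gt0.
have := archi_boundP (ltW (divr_gt0 c_gt0 e_gt0)).
set A := Num.bound _ => ltA; have [i0 i0P] := small A; exists i0 => i /i0P Ar.
have [_ _] := defect_leading_term a_gt0 (nE i) (cE i); apply: lt_le_trans.
rewrite ltrD2l ltrN2.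
have k_gt0 : 0 < 3 ^+ k i :> R by rewrite exprn_gt0.
rewrite mulrA ltr_pdivrMr //.
apply: (@le_lt_trans _ _ (e * (A%:R * (r i)%:R))).
  rewrite (mulrA e) ler_wpM2r // (mulrC e) -ler_pdivrMr //; exact: ltW.
by rewrite ltr_pM2l // -natrM -natrX ltr_nat.
Qed.

(** The defects are bounded, so compactness applies, and along the subsequence they tend both to [z]
    and to C - 3 log_3 a. A single member [n i] is kept: its position relative to [z] is all that is
    used later. *)
Lemma limit_of_defects (n : nat -> nat) z : (forall i, (0 < n i)%N) ->
  (forall i, `|defect R (n i) - z| < i.+1%:R^-1) ->
  exists a C i k r, [/\ (0 < a)%N, n i = (a * 3 ^ k + r)%N,
    complexity (n i) = (C + 3 * k)%N, (complexity a + (0 < r) <= C)%N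
  & z = C%:R - log3_cube a].
Proof.
move=> n_gt0 n_lim.
pose B := Num.bound (`|z| + 1).
have defB i : defect R (n i) <= B%:R.
  apply: (@le_trans _ _ (`|z| + 1)); last first.
    by apply/ltW/archi_boundP; rewrite addr_ge0.
  have : i.+1%:R^-1 <= 1 :> R by rewrite invf_le1 // ler1n.
  have := n_lim i; rewrite ltr_distl => /andP[_].
  have := ler_norm z; move: i.+1%:R^-1 `|z| (defect _ _) => t w d; lra.
have [|phi phi_inc [a [C [k [r asy]]]]] := @has_asymptotics_of_bounded (3 ^ B) n.
  by move=> i; split; rewrite ?n_gt0 //; apply: defect_le_bounded.
have [a_gt0 nE cE aC _] := asy.
exists a, C, (phi 0%N), (k 0%N), (r 0%N); split=> //.
  exact: (nE 0%N).
  exact: (cE 0%N).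
set X := _ - _; apply/eqP; case: (eqVneq z X) => // zX.
have e_gt0 : 0 < `|z - X| / 2 by rewrite divr_gt0 // normr_gt0 subr_eq0.
have [i1 i1P] := asymptotic_defect asy e_gt0.
have [i2 _ i2P] := near_infty_natSinv_lt (PosNum e_gt0).
pose i := maxn i1 i2.
have /= lowX := i1P _ (leq_maxl i1 i2 : (i1 <= i)%N).
have [/= upX _ _] := defect_leading_term a_gt0 (nE i) (cE i).
have /= ei : (phi i).+1%:R^-1 < `|z - X| / 2.
  by apply: i2P; rewrite /= (leq_trans (leq_maxr i1 i2)) // increasing_ge.
have := lt_trans (n_lim (phi i)) ei.
move: upX lowX; rewrite -/X; move: (defect _ _) => d upX + /[!ltr_distl].
by case: (ger0P (z - X)) => ? ? /andP[]; lra.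
Qed.

Lemma closure_ltP (A : set R) x :
  closure A x <-> forall e, 0 < e -> exists2 d, A d & `|x - d| < e.
Proof.
split=> [clA e e_gt0|H B /nbhs_ballP[e /= e_gt0 eB]].
  by have [d [Ad]] := clA _ (nbhsx_ballx x e e_gt0); exists d.
by have [d Ad xd] := H e e_gt0; exists d; split=> //; apply: eB.
Qed.

Local Notation T u := (closure (defects R u)).

Lemma closure_defects_ge0 u x : T u x -> 0 <= x.
Proof.
move=> /closure_ltP Tx; rewrite leNgt; apply/negP => x_lt0.
have [|_ [n [_ _ ->]]] := Tx (- x); first by rewrite oppr_gt0.
by rewrite ltr_distlC => /andP[_]; have := defect_ge0 n; lra.
Qed.

(** The predicate [P] records on which side of [z] the defects lie. *)
Lemma defects_frequently_near u z (P : R -> Prop) :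
  (forall e, 0 < e -> exists2 d, defects R u d & P d /\ `|d - z| < e) ->
  exists n : nat -> nat, forall i, [/\ (1 < n i)%N, (complexity (n i))%:R = u,
    P (defect R (n i)) & `|defect R (n i) - z| < i.+1%:R^-1].
Proof.
move=> H.
suff /choice[n nP] : forall i, exists n : nat, [/\ (1 < n)%N, (complexity n)%:R = u,
    P (defect R n) & `|defect R n - z| < i.+1%:R^-1] by exists n.
move=> i; have [|_ [n [n1 nu ->]] [Pd zd]] := H i.+1%:R^-1.
  by rewrite invr_gt0.
by exists n.
Qed.

(** Otherwise defects greater than [x] would tend to [x], whereas [limit_of_defects] yields one that
    is at most its limit. *)
Lemma closure_defects_gap u x :
  exists2 e, 0 < e & forall s, T u s -> ~ (x < s < x + e).
Proof.
apply: contrapT => H.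
have [|n nP] := @defects_frequently_near u x (fun d => x < d).
  move=> e e_gt0; apply: contrapT => G; apply: H; exists e => // s /closure_ltP Ts.
  move=> /andP[xs sx]; apply: G.
  have [|d ud sd] := Ts (Num.min (s - x) (x + e - s)).
    by rewrite lt_min !subr_gt0 xs.
  exists d => //; move: sd; rewrite lt_min !ltr_distl.
  by move=> /andP[/andP[? ?] /andP[? ?]]; split; [|apply/andP; split]; lra.
have [i|i|a [C [i [k [r [a0 nE cE _ xE]]]]]] := @limit_of_defects n x.
- by have [/ltnW] := nP i.
- by have [] := nP i.
have [_ _ lt_x _] := nP i.
by have [] := defect_leading_term a0 nE cE; rewrite -xE leNgt lt_x.
Qed.

Lemma natr_Z3_add3 C k : (C + 3 * k)%N%:R = C%:R :> 'Z_3.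
Proof.
have e3 : 3%:R = 0 :> 'Z_3 by apply: val_inj.
by rewrite natrD natrM e3 mul0r addr0.
Qed.

(** The witness is q 3^k + 1 for a large k, whose defect tends to [defect q + 1] from below. *)
Lemma stable_near q e : (1 < q)%N -> stable q -> 0 < e ->
  exists q', [/\ (1 < q')%N, stable q',
    (complexity q')%:R = (complexity q).+1%:R :> 'Z_3
    & defect R q + 1 - e < defect R q' < defect R q + 1].
Proof.
move=> q1 q_st e_gt0; have q_gt0 := ltnW q1.
have [k0 k0P] := stable_succ q_gt0 q_st.
pose n k := (q * 3 ^ (k0 + k) + 1)%N.
have cn k : complexity (n k) = (complexity q + 3 * (k0 + k) + 1)%N.
  by have := k0P _ (leq_addr k k0) 0%N; rewrite !muln1 muln0 addn0.
have asy : asymptotic n q (complexity q).+1 (addn k0) (fun=> 1%N).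
  split=> // [k|k|A]; first by rewrite cn; lia.
    by rewrite addn1.
  exists A => k Ak; rewrite muln1; apply: (leq_ltn_trans Ak).
  by rewrite (leq_trans (@ltn_expl 3 k _)) // leq_exp2l // leq_addl.
have [k kP] := asymptotic_defect asy e_gt0.
have {kP} := kP _ (leqnn k).
have [_ nE cE _ _] := asy.
have [_ + _] := defect_leading_term q_gt0 (nE k) (cE k) => /(_ isT).
have -> : (complexity q).+1%:R - log3_cube q = defect R q + 1.
  by rewrite /defect /log3_cube -natr1; lra.
move=> lt_z gt_z; exists (n k); split=> //; last by rewrite gt_z.
- by rewrite /n; have := @ltn_expl 3 (k0 + k) isT; nia.
- move=> l; have := k0P _ (leq_addr k k0) l; rewrite -/(n k) cn; lia.
- by rewrite cE natr_Z3_add3.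
Qed.

(** Replacing [q] by the [q'] of [stable_near] absorbs one unit of [m] up to an arbitrarily small
    error. *)
Lemma closure_defects_stable m q : (1 < q)%N -> stable q ->
  T (complexity q + m)%N%:R (defect R q + m%:R).
Proof.
elim: m q => [|m IH] q q1 q_st.
  by rewrite addn0 addr0; apply: subset_closure; exists q.
apply/closure_ltP => e e_gt0; have e2 : 0 < e / 2 by rewrite divr_gt0.
have [q' [q'1 q'_st cq' /andP[lo hi]]] := stable_near q1 q_st e2.
have /closure_ltP/(_ _ e2)[d dD dq'] := IH q' q'1 q'_st.
exists d; first by move: dD; rewrite natrD cq' -natrD addSnnS.
by move: dq'; rewrite -[m.+1%:R]natr1 !ltr_distl; move: (m%:R : R) => t /andP[? ?]; apply/andP; split; lra.
Qed.

(** Here [m] is what the stable multiple saves over the complexity of [n] plus 3 for each factor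
    3. *)
Lemma defect_stable n : (0 < n)%N -> exists q m, [/\ (1 < q)%N, stable q,
  defect R n = defect R q + m%:R & (complexity n)%:R = (complexity q + m)%N%:R :> 'Z_3].
Proof.
move=> n_gt0; have [K K_st] := stable_exists n_gt0.
have le_c := complexity_mul3X K.+1 n_gt0.
exists (n * 3 ^ K.+1)%N, (complexity n + 3 * K.+1 - complexity (n * 3 ^ K.+1))%N.
split=> //.
- by have := @ltn_expl 3 K.+1 isT; nia.
- rewrite /defect -/(log3_cube n) -/(log3_cube (_ * _)) log3_cube_mul3X //.
  by rewrite natrB // natrD natrM; lra.
- by rewrite subnKC // natr_Z3_add3.
Qed.

Lemma closure_defects_shift n m : (0 < n)%N ->
  T (complexity n + m)%N%:R (defect R n + m%:R).
Proof.
move=> /defect_stable[q [m' [q1 q_st -> cE]]].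
rewrite natrD cE -natrD -addrA -natrD -addnA.
exact: closure_defects_stable.
Qed.

(** * Left limits of the closure *)

Definition left_limit (S : set R) z :=
  forall e, 0 < e -> exists2 s, S s & z - e < s < z.

Lemma left_limit_closure u z : left_limit (T u) z -> T u z.
Proof.
move=> lim; apply/closure_ltP => e e_gt0; have e2 : 0 < e / 2 by rewrite divr_gt0.
have [s /closure_ltP/(_ _ e2)[d dD sd] /andP[? ?]] := lim _ e2.
exists d => //.
by move: sd; rewrite !ltr_distl => /andP[? ?]; apply/andP; split; lra.
Qed.

(** The gap above [x] forces nearby defects to be at most [x]. Writing such a defect as
    [defect q + m] with [q] stable, [stable_near] provides points just below [defect q + m + 1]. *)
Lemma left_limit_succ u x : T u x -> left_limit (T (u + 1)) (x + 1).
Proof.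
move=> /closure_ltP Tx e e_gt0.
have [e' e'_gt0 gap] := closure_defects_gap u x.
have e2 : 0 < e / 2 by rewrite divr_gt0.
have [|_ [n [n1 nu ->]] xd] := Tx (Num.min e' (e / 2)).
  by rewrite lt_min e'_gt0.
have dx : defect R n <= x.
  rewrite leNgt; apply/negP => lt_x; apply: (gap (defect R n)).
    by apply: subset_closure; exists n.
  by rewrite lt_x /=; move: xd; rewrite lt_min !ltr_distlC => /andP[/andP[? ?] _].
have [q [m [q1 q_st dE cE]]] := defect_stable (ltnW n1).
have [q' [q'1 q'_st cq' /andP[lo hi]]] := stable_near q1 q_st e2.
exists (defect R q' + m%:R).
  have := @closure_defects_shift q' m (ltnW q'1).
  by rewrite natrD cq' -nu cE natr1 -natrD addSn.
move: xd; rewrite lt_min !ltr_distlC => /andP[_ /andP[? ?]].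
by move: dx; rewrite dE => dx; apply/andP; split; lra.
Qed.

(** Approach from strictly below forces a nonzero remainder, hence ||a|| <= C - 1, and z - 1 is the
    defect of [a] plus the natural number C - 1 - ||a||. *)
Lemma left_limit_pred u z : left_limit (T (u + 1)) z -> T u (z - 1).
Proof.
move=> lim; have [|n nP] := @defects_frequently_near (u + 1) z (fun d => d < z).
  move=> e e_gt0; have [s /closure_ltP Ts /andP[zs sz]] := lim e e_gt0.
  have [|d dD] := Ts (Num.min (z - s) (s - (z - e))).
    by rewrite lt_min !subr_gt0 zs sz.
  rewrite lt_min !ltr_distl => /andP[/andP[? ?] /andP[? ?]].
  by exists d => //; split; rewrite ?ltr_distl; [|apply/andP; split]; lra.
have [i|i|a [C [i [k [r [a0 nE cE aC zE]]]]]] := @limit_of_defects n z.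
- by have [/ltnW] := nP i.
- by have [] := nP i.
have [_ nu lt_z _] := nP i.
have r_gt0 : (0 < r)%N.
  rewrite lt0n; apply/eqP => r0; move: lt_z; rewrite ltNge => /negP; apply.
  have [_ _] := defect_leading_term a0 nE cE.
  by rewrite r0 mul0r mulr0 subr0 -zE.
rewrite r_gt0 addn1 in aC.
have := @closure_defects_shift a (C.-1 - complexity a) a0.
have C_gt0 : (0 < C)%N := leq_ltn_trans (leq0n _) aC.
have aC' : (complexity a <= C.-1)%N by rewrite -ltnS prednK.
rewrite subnKC //.
have -> : (C.-1)%:R = u :> 'Z_3.
  by apply: (addIr 1); rewrite natr1 prednK // -nu cE natr_Z3_add3.
congr (closure _ _); rewrite zE /defect -/(log3_cube a) natrB //.
by rewrite -[in RHS](prednK C_gt0) -natr1; lra.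
Qed.

(** By the gap above the infimum, elements of [A] close to it must equal it. *)
Lemma closure_defects_min u (A : set R) : A `<=` T u -> A !=set0 ->
  exists2 m, A m & forall s, A s -> m <= s.
Proof.
move=> AT A0; have infA : has_inf A.
  by split=> //; exists 0 => s /AT /closure_defects_ge0.
have lbA s : A s -> inf A <= s by apply: ge_inf; case: infA.
case: (pselect (A (inf A))) => [Am|nAm]; first by exists (inf A).
have [e e_gt0 gap] := closure_defects_gap u (inf A).
have [s As s_lt] := inf_adherent e_gt0 infA.
case: (gap s (AT _ As)); rewrite s_lt andbT lt_neqAle lbA // andbT.
by apply/eqP => sE; apply: nAm; rewrite sE.
Qed.

Lemma closure_defects_nonempty u : T u !=set0.
Proof.
have c2 : complexity 2 = 2%N.
  apply/eqP; rewrite eqn_leq (complexity_min (Add One One)) /=.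
  exact: complexity_ge.
have c3 : complexity 3 = 3%N := @complexity3X 1 isT.
have c4 : complexity 4 = 4%N.
  apply/eqP; rewrite eqn_leq (complexity_min (Mul (Add One One) (Add One One))) /=.
  exact: complexity_ge.
have [n [n1 nu]] : exists n, (1 < n)%N /\ (complexity n)%:R = u.
  (* Defects are taken over n > 1 only, so 4 rather than 1 represents class 1. *)
  case: u => [[|[|[|//]]]] lt_u.
  - by exists 3%N; split=> //; rewrite c3; apply: val_inj.
  - by exists 4%N; split=> //; rewrite c4; apply: val_inj.
  - by exists 2%N; split=> //; rewrite c2; apply: val_inj.
by exists (defect R n); apply: subset_closure; exists n.
Qed.

End Defects.

(** * Ordinal indexing *)

Lemma slexprodE (A B : Type) (ltA : A -> A -> Prop) (ltB : B -> B -> Prop) p q :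
  slexprod A B ltA ltB p q <-> ltA p.1 q.1 \/ p.1 = q.1 /\ ltB p.2 q.2.
Proof.
case: p q => [p1 p2] [q1 q2]; split=> [H|/= [H|[<- H]]].
- by inversion H; subst; [left | right].
- exact: left_slex.
- exact: right_slex.
Qed.

Lemma has_order_type_homo (T : Type) (lt : T -> T -> Prop) (P : set T)
    (a : wellord) (f : a -> T) :
  (forall x, ~ lt x x) -> (forall x y z, lt x y -> lt y z -> lt x z) ->
  (forall i j, wo_rel i j -> lt (f i) (f j)) -> range f = P ->
  has_order_type lt P a.
Proof.
move=> lt_irr lt_tr f_homo f_rg; exists f; split=> // i j; split; first exact: f_homo.
case: (wo_total i j) => [//|->|/f_homo ji] ij; first by case: (lt_irr _ ij).
by case: (lt_irr _ (lt_tr _ _ _ ij ji)).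
Qed.

Lemma wo_eq_homo (a b : wellord) (f : a -> b) :
  (forall i j, wo_rel i j -> wo_rel (f i) (f j)) -> (forall y, exists i, f i = y) ->
  wo_eq a b.
Proof.
move=> f_homo f_onto; apply: (has_order_type_homo _ _ f_homo).
- exact: wo_irr.
- exact: wo_trans.
- by apply/seteqP; split=> // y _; have [i <-] := f_onto y; exists i.
Qed.

Lemma has_order_type_wo_eq (T : Type) (lt : T -> T -> Prop) (P : set T) (a b : wellord) :
  wo_eq a b -> has_order_type lt P b -> has_order_type lt P a.
Proof.
move=> [g [g_lt g_rg]] [f [f_lt f_rg]]; exists (f \o g); split=> [i j|].
  by rewrite g_lt f_lt.
rewrite -f_rg; apply/seteqP; split=> [_ [i _ <-]|_ [j _ <-]]; first by exists (g i).
by have [i _ <-] : range g j by [rewrite g_rg]; exists i.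
Qed.

Lemma wo_mul1 a : wo_eq (wo_mul wo_one a) a.
Proof.
apply: (@wo_eq_homo (wo_mul wo_one a) a fst) => [i j /slexprodE[//|[_ []]]|y].
by exists (y, tt).
Qed.

Lemma wo_mulr1 a : wo_eq a (wo_mul a wo_one).
Proof.
apply: (@wo_eq_homo a (wo_mul a wo_one) (pair tt)) => [i j ij|[[] i]].
  by apply/slexprodE; right.
by exists i.
Qed.

Lemma wo_mulA a b c : wo_eq (wo_mul (wo_mul a b) c) (wo_mul a (wo_mul b c)).
Proof.
apply: (@wo_eq_homo (wo_mul (wo_mul a b) c) (wo_mul a (wo_mul b c))
  (fun p => ((p.1, p.2.1), p.2.2))) => [i j ij|[[z y] x]]; last by exists (z, (y, x)).
move: ij => /slexprodE ij; apply/slexprodE => /=.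
case: ij => [ij|[<- /slexprodE[ij|[<- ij]]]].
- by left; apply/slexprodE; left.
- by left; apply/slexprodE; right.
- by right.
Qed.

Lemma wo_sub_wf (a : wellord) (P : a -> Prop) :
  well_founded (fun i j : {i : a | P i} => wo_rel (sval i) (sval j)).
Proof. exact: (wf_inverse_image _ _ _ _ (@wo_wf a)). Qed.

Lemma wo_sub_total (a : wellord) (P : a -> Prop) (i j : {i : a | P i}) :
  [\/ wo_rel (sval i) (sval j), i = j | wo_rel (sval j) (sval i)].
Proof.
case: (wo_total (sval i) (sval j)) => [?|ij|?]; [exact: Or31 | | exact: Or33].
by apply: Or32; apply: eq_sig_hprop => // k; apply: Prop_irrelevance.
Qed.

Definition wo_sub (a : wellord) (P : a -> Prop) : wellord :=
  @Wellord {i : a | P i} (fun i j => wo_rel (sval i) (sval j)) (@wo_sub_wf a P)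
    (fun i j k => @wo_trans a (sval i) (sval j) (sval k)) (@wo_sub_total a P).

Section Indexing.
Variable R : realType.
Implicit Types (S T : set R) (a b : wellord).

Local Notation order_type := (has_order_type (fun y z : R => y < z)).

(* For a set [S] of nonnegative reals, [-1] plays the role of the additional
   bottom element in [1 + b = a]. *)
Definition bottom_below S x : set R := [set y | y = -1 \/ S y /\ y < x].

Definition indexed S a x := S x /\ order_type (bottom_below S x) a.

Lemma indexed_wo_eq S a b x : wo_eq a b -> indexed S b x -> indexed S a x.
Proof. by move=> ab [Sx Sb]; split=> //; apply: has_order_type_wo_eq Sb. Qed.

Lemma strictly_increasing_inj a (f : a -> R) :
  (forall i j, wo_rel i j <-> f i < f j) -> injective f.
Proof.
by move=> f_lt i j fij; case: (wo_total i j) => // /f_lt; rewrite fij ltxx.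
Qed.

Lemma indexed_elt_at1 S a x : (forall s, S s -> 0 <= s) -> indexed S a x ->
  elt_at1 S a x.
Proof.
move=> S_ge0 [Sx [f [f_lt f_rg]]].
have fP i : bottom_below S x (f i) by rewrite -f_rg; exists i.
have f_onto y : bottom_below S x y -> exists i, f i = y.
  by rewrite -f_rg => -[i _ <-]; exists i.
have f_inj := strictly_increasing_inj f_lt.
have [i0 fi0] : exists i, f i = -1 by apply: f_onto; left.
(* Removing the least element of [a], the preimage of [-1], leaves [b] with 1 + b = a. *)
pose b := @wo_sub a (fun i => f i <> -1).
have gt_bot (i : b) : -1 < f (sval i).
  by case: i => i /= ni; case: (fP i) => // -[/S_ge0 ? _]; lra.
exists b; split; last first.
  split=> //; exists (f \o sval); split=> [i j|]; first exact: f_lt.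
  apply/seteqP; split=> [_ [i _ <-]|y [Sy yx]] /=.
    by have := gt_bot i; case: (fP (sval i)) => [->|//]; rewrite ltxx.
  have [i fi] : exists i, f i = y by apply: f_onto; right.
  have ni : f i <> -1 by move=> fi1; have := S_ge0 _ Sy; lra.
  by exists (exist _ i ni).
apply: (@wo_eq_homo (wo_add wo_one b) a
  (fun i => match i with inl _ => i0 | inr j => sval j end)).
  move=> i j ij; inversion ij; subst => //.
  by apply/f_lt; rewrite fi0.
move=> i; case: (pselect (f i = -1)) => fi; last by exists (inr (exist _ i fi)).
by exists (inl tt); apply: f_inj; rewrite fi0 fi.
Qed.

(* The elements of [S] from one left limit (or from the bottom) up to the next
   one form a copy of omega, enumerated by the successor function of [S]. *)
Lemma indexed_omega S T a x :
  (forall s, T s -> 0 <= s) ->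
  (forall A : set R, A `<=` S -> A !=set0 -> exists2 m, A m & forall s, A s -> m <= s) ->
  (forall s, S s -> 0 <= s) ->
  (forall z, left_limit S z -> S z) ->
  (forall z, T z -> left_limit S (z + 1)) ->
  (forall z, left_limit S z -> T (z - 1)) ->
  indexed T a x -> indexed S (wo_mul wo_omega a) (x + 1).
Proof.
move=> T_ge0 S_min S_ge0 S_cl T_lim lim_T [Tx [f [f_lt f_rg]]].
have fP i : bottom_below T x (f i) by rewrite -f_rg; exists i.
have f_onto y : bottom_below T x y -> exists i, f i = y.
  by rewrite -f_rg => -[i _ <-]; exists i.
have f_ge i : -1 <= f i by case: (fP i) => [->//|[/T_ge0 ? _]]; lra.
(* The copy of omega with index [i] starts at [h i]: the bottom, or the left limit [f i + 1]. *)
pose h i := if f i == -1 then -1 else f i + 1.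
have hP i : h i = -1 \/ left_limit S (h i) /\ h i < x + 1.
  rewrite /h; case: eqP => [_|ne]; [by left | right].
  by case: (fP i) => // -[/T_lim lim fx]; rewrite ltrD2r.
have h_homo i j : wo_rel i j -> h i < h j.
  move=> /f_lt fij; rewrite /h; have := f_ge i.
  by case: eqP => _; case: eqP => ?; lra.
have h_lim i j : wo_rel i j -> left_limit S (h j).
  move=> ij; have := h_homo _ _ ij; case: (hP j) => [->|[]//].
  by case: (hP i) => [->|[/S_cl/S_ge0]]; [rewrite ltxx | lra].
have [z|next nextP] := @choice R R (fun z s => (exists2 t, S t & z < t) ->
    [/\ S s, z < s & forall t, S t -> z < t -> s <= t]).
  have [[t St zt]|no_t] := pselect (exists2 t, S t & z < t); last by exists z.
  have [|| s [Ss zs] s_min] := S_min [set s | S s /\ z < s].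
  - by move=> s [].
  - by exists t.
  by exists s => _; split=> // t' St' zt'; apply: s_min.
(* Elements of [S] accumulate below [w], so successors never reach a left limit. *)
have next_lim z w : left_limit S w -> z < w -> [/\ S (next z), z < next z & next z < w].
  move=> lim zw; have [|t St /andP[zt tw]] := lim (w - z); first by rewrite subr_gt0.
  have {}zt : z < t by lra.
  have [|Sn zn n_min] := nextP z; first by exists t.
  by split=> //; apply: le_lt_trans tw; apply: n_min.
have x_lim := T_lim _ Tx.
pose g (p : a * nat) := iter p.2 next (h p.1).
have g_lim i n w : left_limit S w -> h i < w -> g (i, n) < w.
  move=> lim hw; elim: n => // n IH; rewrite /g /=.
  by have [] := next_lim _ _ lim IH.
have h_ltx i : h i < x + 1 by case: (hP i) => [->|[]//]; have := T_ge0 _ Tx; lra.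
have g_ltx i n : g (i, n) < x + 1 by apply: g_lim.
have g_succ i n : g (i, n) < g (i, n.+1).
  by have [] := next_lim _ _ x_lim (g_ltx i n).
have g_homo i m n : (m < n)%N -> g (i, m) < g (i, n).
  elim: n => // n IH; rewrite ltnS leq_eqVlt => /orP[/eqP->|/IH h1]; first exact: g_succ.
  exact: lt_trans h1 (g_succ _ _).
split; first exact: S_cl.
apply: (@has_order_type_homo _ _ _ (wo_mul wo_omega a) g).
- by move=> y; rewrite ltxx.
- by move=> y z t; apply: lt_trans.
- move=> [i m] [j n] /slexprodE[/= ij|[/= -> mn]]; last exact: g_homo.
  have h1 : g (i, m) < h j by apply: g_lim; [apply: h_lim ij | apply: h_homo].
  apply: (lt_le_trans h1); case: n => [//|n]; apply: ltW.
  exact: (g_homo j 0%N n.+1).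
apply/seteqP; split=> [_ [[i n] _ <-]|].
  case: n => [|n]; last first.
    by right; split; [have [] := next_lim _ _ x_lim (g_ltx i n) | apply: g_ltx].
  by case: (hP i) => [|[/S_cl ? ?]]; [left | right].
have bot_rg : range g (-1).
  have [|i fi] := f_onto (-1); first by left.
  by exists (i, 0%N) => //; rewrite /g /= /h fi eqxx.
move=> z [->//|[Sz zx]]; apply: contrapT => nz.
(* The least element [z0] missed by [g] is no left limit, as those are values of [h]. So there is a
   largest element below it, which is a value of [g] and has [z0] as its successor. *)
have [||z0 [Sz0 z0x nz0] z0_min] := S_min [set z | [/\ S z, z < x + 1 & ~ range g z]].
- by move=> ? [].
- by exists z.
have below_rg s : bottom_below S z0 s -> range g s.
  move=> [->//|[Ss sz0]]; apply: contrapT => ns.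
  suff /z0_min : [/\ S s, s < x + 1 & ~ range g s] by rewrite leNgt sz0.
  by split=> //; apply: lt_trans z0x.
have nlim : ~ left_limit S z0.
  move=> lim; apply: nz0.
  have [|i fi] := f_onto (z0 - 1).
    by right; split; [apply: lim_T | lra].
  exists (i, 0%N) => //; rewrite /g /= /h fi.
  by case: eqP => [e|_]; [have := T_ge0 _ (lim_T _ lim); lra | rewrite subrK].
set P := bottom_below S z0 in below_rg.
have P_bot : P (-1) by left.
have P_ub : ubound P z0 by move=> s [->|[_ /ltW//]]; have := S_ge0 _ Sz0; lra.
have supP : has_sup P by split; [exists (-1) | exists z0].
have sup_ub s : P s -> s <= sup P by move=> Ps; apply: ub_le_sup => //; exists z0.
have sup_le : sup P <= z0 by apply: ge_sup => //; exists (-1).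
(* An unattained supremum would be a left limit of [S], hence in [S] and different from [z0], hence
   in [P]. *)
have Psup : P (sup P).
  apply: contrapT => nP.
  have bot_lt : -1 < sup P.
    by rewrite lt_neqAle sup_ub // andbT; apply/eqP => e; apply: nP; rewrite -e.
  have lim : left_limit S (sup P).
    move=> e e_gt0.
    (* The bound [sup P + 1] keeps [s] above the bottom [-1]. *)
    have [|s Ps lt_s] := @sup_adherent _ P (Num.min e (sup P + 1)) _ supP.
      by rewrite lt_min e_gt0 /=; lra.
    have s_lt : s < sup P.
      by rewrite lt_neqAle sup_ub // andbT; apply/eqP => es; apply: nP; rewrite -es.
    have [bot_s e_s] : -1 < s /\ sup P - e < s.
      have : Num.min e (sup P + 1) <= e by rewrite ge_min lexx.
      have : Num.min e (sup P + 1) <= sup P + 1 by rewrite ge_min lexx orbT.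
      by move: (Num.min _ _) lt_s; move: (sup P) => p t; split; lra.
    case: Ps => [es|[Ss _]]; first by rewrite es ltxx in bot_s.
    by exists s => //; rewrite e_s.
  apply: nP; right; split; first exact: S_cl.
  rewrite lt_neqAle sup_le andbT; apply/eqP => e; apply: nlim; by rewrite -e.
have [[i n] _ gE] := below_rg _ Psup.
have sup_lt : sup P < z0.
  by case: Psup => [->|[]//]; have := S_ge0 _ Sz0; lra.
have [|Sn gn n_min] := nextP (sup P); first by exists z0.
apply: nz0; exists (i, n.+1) => //; rewrite /g /= -/(g (i, n)) gE.
apply/eqP; rewrite eq_le n_min //= leNgt; apply/negP => lt_z0.
have : P (next (sup P)) by right.
by move=> /sup_ub; rewrite leNgt gn.
Qed.

Local Notation T u := (closure (defects R u)).

(** Each step multiplies by omega on the left of [a], and associativity gathers the factors into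
    [omega_pow k]. *)
Lemma indexed_omega_pow k u a x : indexed (T u) a x ->
  indexed (T (u + k%:R)) (wo_mul (omega_pow k) a) (x + k%:R).
Proof.
elim: k u a x => [|k IH] u a x ax.
  by rewrite !addr0; apply: indexed_wo_eq ax; apply: wo_mul1.
have := @indexed_omega (T (u + 1)) (T u) a x (@closure_defects_ge0 R u)
  (@closure_defects_min R (u + 1)) (@closure_defects_ge0 R (u + 1))
  (@left_limit_closure R (u + 1)) (@left_limit_succ R u) (@left_limit_pred R u) ax.
move=> /IH; rewrite -!addrA -!mulrS; apply: indexed_wo_eq.
exact: wo_mulA.
Qed.

(** The minimum of the closure for class [u - n] has index 1, so shifting it by [n] gives an element
    of index omega^n for class [u]. As [a] is a proper initial segment of omega^n, ending before
    [j], the element enumerated at [j] has index [a]. *)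
Lemma indexed_exists u a : wo_le wo_one a -> lt_omega_omega a ->
  exists x, indexed (T u) a x.
Proof.
move=> a_ge1 [n [j [h [h_lt h_rg]]]].
have [i0] : exists i : a, True.
  by case: a_ge1 => [[i _]|[f _]]; [exists i | exists (f tt)].
move=> _.
have [m Tm m_min] := @closure_defects_min R (u - n%:R) _ (@subset_refl _ _)
  (@closure_defects_nonempty R _).
have ix1 : indexed (T (u - n%:R)) wo_one m.
  split=> //; exists (fun=> -1); split=> [i k|]; first by rewrite ltxx.
  apply/seteqP; split=> [_ [i _ <-]|y [->|[/m_min]]]; first by left.
    by exists tt.
  by rewrite leNgt => /negP.
have := indexed_omega_pow n ix1; rewrite subrK.
move=> /(indexed_wo_eq (wo_mulr1 _)) [_ [g [g_lt g_rg]]].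
have gP i : bottom_below (T u) (m + n%:R) (g i) by rewrite -g_rg; exists i.
have g_onto y : bottom_below (T u) (m + n%:R) y -> exists i, g i = y.
  by rewrite -g_rg => -[i _ <-]; exists i.
have hj i : wo_rel (h i) j by have : range h (h i) by [exists i]; rewrite h_rg.
(* Since [a] is nonempty, [j] is not least, so [g j] is not the bottom. *)
have gj_gt : -1 < g j.
  have /g_lt := hj i0; apply: le_lt_trans.
  by case: (gP (h i0)) => [->//|[/closure_defects_ge0 ? _]]; lra.
have [Tgj gj_lt] : T u (g j) /\ g j < m + n%:R.
  by case: (gP j) => // gj1; rewrite gj1 ltxx in gj_gt.
exists (g j); split=> //; exists (g \o h); split=> [i k|]; first by rewrite h_lt g_lt.
apply/seteqP; split=> [_ [i _ <-]|y yP].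
  by case: (gP (h i)) => [|[? _]]; [left | right; split=> //; apply/g_lt].
have [|i gi] := g_onto y.
  by case: yP => [|[? /lt_trans lt_y]]; [left | right; split=> //; apply: lt_y].
have ij : wo_rel i j by apply/g_lt; rewrite gi; case: yP => [->|[]].
have [i' _ hi'] : range h i by rewrite h_rg.
by exists i' => //=; rewrite hi'.
Qed.

End Indexing.

Unset Implicit Arguments.

Theorem theorem1p7 (R : realType) (a : wellord) (k : nat) (u : 'Z_3)
    (a_ge1 : wo_le wo_one a) (a_lt : lt_omega_omega a) :
  exists x y : R,
    [/\ elt_at1 (closure (defects R u)) a x,
        elt_at1 (closure (defects R (u + k%:R))) (wo_mul (omega_pow k) a) y
      & y = x + k%:R].
Proof.
have [x ux] := @indexed_exists R u a a_ge1 a_lt.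
exists x, (x + k%:R); split=> //; apply: indexed_elt_at1.
- exact: closure_defects_ge0.
- exact: ux.
- exact: closure_defects_ge0.
- exact: indexed_omega_pow.
Qed.
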